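(* Let $n\ge 3$ and $d\ge 1$ be integers. Every integer eigenvalue of $C_n^{(d)}$ admits a simply structured eigenspace basis; that is, for every integer $\lambda$ that is an eigenvalue of the adjacency matrix $A$ of $C_n^{(d)}$, the eigenspace $\{x\in\mathbb{R}^n : Ax=\lambda x\}$ has a basis consisting of vectors all of whose entries lie in $\{-1,0,1\}$.
   Context: $C_n$ denotes the circuit (cycle) graph on $n$ vertices. For a graph $G$ and a positive integer $d$, the $d$-th distance power $G^{(d)}$ is the graph obtained from $G$ by adding edges between all pairs of distinct vertices whose distance in $G$ is at most $d$. The eigenvalues and eigenspaces of a graph are those of its adjacency matrix. A basis of an eigenspace is called simply structured if its vectors contain only entries from the set $\{-1,0,1\}$. *)

(* Defs.v *)
From HB Require Import structures.
From mathcomp Require Import all_boot all_order all_algebra.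
From mathcomp Require Import reals.

Set Implicit Arguments.
Unset Strict Implicit.
Unset Printing Implicit Defensive.

Import Order.TTheory GRing.Theory Num.Theory.
Local Open Scope ring_scope.

(* A graph on the finite vertex type T is represented by its adjacency
   relation e : rel T. *)

Definition has_walk (T : finType) (e : rel T) (k : nat) (x y : T) : bool :=
  [exists p : k.-tuple T, path e x p && (last x p == y)].

(* The least length of a walk from x to y. A shortest walk has fewer than
   #|T| edges, so the search range is large enough; when x and y are not
   connected, the value is the dummy #|T|, to be guarded by connect e x y. *)
Definition gdist (T : finType) (e : rel T) (x y : T) : nat :=
  find (fun k => has_walk e k x y) (iota 0 #|T|).

Definition dist_power (T : finType) (e : rel T) (d : nat) : rel T :=
  [rel x y | e x y || [&& x != y, connect e x y & (gdist e x y <= d)%N]].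

(* ordS i is i + 1 modulo n; this is a simple graph as soon as n >= 3. *)
Definition circuit (n : nat) : rel 'I_n :=
  [rel i j | (j == ordS i) || (i == ordS j)].

Definition adjmx (R : realType) (n : nat) (e : rel 'I_n) : 'M[R]_n :=
  \matrix_(i, j) (e i j)%:R.

(* The library's matrix eigenspace acts on row vectors (v *m A = a *: v);
   the endomorphism x |-> A *m x gives the column version. *)
Definition mxend (R : realType) (n : nat) (A : 'M[R]_n) : 'End('cV[R]_n) :=
  linfun (mulmx A).

Lemma mem_leigenspace_mxend (R : realType) (n : nat) (A : 'M[R]_n) (a : R)
    (x : 'cV[R]_n) :
  (x \in passmx.leigenspace (mxend A) a) = (A *m x == a *: x).
Proof.
by rewrite memv_ker add_lfunE opp_lfunE scale_lfunE id_lfunE lfunE /= subr_eq0.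
Qed.

Definition simply_structured (R : realType) (n : nat) (b : seq 'cV[R]_n) :=
  forall x, x \in b -> forall i, x i 0 \in [:: -1; 0; 1].

(* Main.v *)
Require Import Defs.
From HB Require Import structures.
From mathcomp Require Import all_boot all_order all_algebra.
From mathcomp Require Import reals.
From mathcomp Require Import all_field ring lra zify.

(** Put mu = lam + 1. Adding the identity to the adjacency matrix turns the
    eigenvalue equation into a statement about sums over closed
    neighbourhoods, which on the circuit are arcs: x is an eigenvector iff
      x_i + x_(i+1) + ... + x_(i+L-1) = mu x_(i+d)   for all i mod n,
    where L = min(n, 2d+1) ([window_eq], [eigen_winmx]). Taking the minimum
    covers the complete graph, where the arc is the whole circuit.

    The equation commutes with rotation, so over the algebraic numbers its
    solution space is spanned by the geometric rows (z^j)_j, for the n-th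
    roots of unity z with 1 + z + ... + z^(L-1) = mu z^d ([fourier_inversion],
    [fourier_support]). Its matrix has rational entries, so it is enough to
    write each such row as an algebraic combination of rational solutions with
    entries in {-1,0,1}: the inclusion of the kernel in the span of all these
    solutions then holds over the rationals, hence over the reals
    ([ker_winmx_sub]), and a basis can be extracted from the spanning family.

    The arithmetic input is that the equation leaves few possibilities when
    mu is an integer and z <> 1, L = 2d+1. It reads
      z^(2d+1) - 1 = mu z^d (z - 1).
    If mu = 0, then z^(2d+1) = 1. If mu = 1 or -1, the equation factors as
    (z^d - mu)(z^(d+1) + mu) = 0. If |mu| >= 2, the algebraic integer
    alpha = z^d (z - 1) has all its conjugates of the form (w - 1)/mu with w
    a root of unity, so they have modulus at most 2/|mu| <= 1; their product
    is a nonzero integer, so |alpha| = |z - 1| = 1 and z is a primitive sixth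
    root of unity ([root_unity_window]).

    In the first cases z^e = 1 or z^e = -1 for some e related to the length
    of the arc. If N is the order of z, the N-periodic sequences which are the
    difference of the indicators of two residue classes mod N, t apart, span
    (1 - z^t) z^i, and t can be chosen such that z^t <> 1 and that these
    sequences inherit the sign rule of z^i under a shift by e; this rule and
    the vanishing of their sum over a period are all that the equation needs
    ([power_row_sub], [step_half]). For a sixth root of unity,
    z^i = a_i + b_i z with a_i and b_i in {-1,0,1}, and since 1 and z are
    linearly independent over the rationals, the sequences a and b satisfy the
    equation because z^i does ([sixth_power_row_sub]). *)

Set Implicit Arguments.
Unset Strict Implicit.
Unset Printing Implicit Defensive.

Import Order.TTheory GRing.Theory Num.Theory.
Local Open Scope ring_scope.

(** * Integer values of quotients of roots of unity *)

(** A zero constant term would allow division of the minimal polynomial by 'X,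
    leaving a polynomial of smaller degree that vanishes at x. *)
Lemma minCpoly_coef0_neq0 (x : algC) : x != 0 -> (minCpoly x)`_0 != 0.
Proof.
move=> x0; have [p [Dp mon_p] min_p] := minCpolyP x.
rewrite Dp coef_map fmorph_eq0; apply/eqP=> p0.
have p_neq0 := monic_neq0 mon_p.
have /factor_theorem[q Dq] : root p 0 by rewrite /root horner_coef0 p0.
have : root (map_poly ratr p) x by rewrite min_p.
rewrite Dq rmorphM rootM rmorphB /= map_polyX map_polyC /= rmorph0 subr0.
rewrite rootX (negPf x0) orbF min_p Dq subr0.
have q_neq0 : q != 0 by apply: contra_neq p_neq0 => q0; rewrite Dq q0 mul0r.
by move/(dvdp_leq q_neq0); rewrite size_mulX ?ltnn.
Qed.

Lemma prod_norm_le1_eq1 (s : seq algC) :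
    (forall y, y \in s -> `|y| <= 1) -> 1 <= \prod_(y <- s) `|y| ->
  forall y, y \in s -> `|y| = 1.
Proof.
move=> s_le1 s_ge1 y sy; apply/eqP; rewrite eq_le s_le1 //=.
apply: le_trans s_ge1 _; rewrite (perm_big _ (perm_to_rem sy)) big_cons /=.
apply: ler_piMr => //; rewrite big_seq; apply: prodr_ile1 => u /mem_rem su.
by rewrite normr_ge0 s_le1.
Qed.

(** The product of all conjugates is, up to sign, the constant term of the
    minimal polynomial, a nonzero integer; its modulus is at least 1, so no
    factor can have modulus less than 1. This is the first step of Kronecker's
    theorem on algebraic integers in the unit disc. *)
Lemma Aint_conjugates_le1 (x : algC) :
    x \in Aint -> x != 0 -> (forall y, root (minCpoly x) y -> `|y| <= 1) ->
  `|x| = 1.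
Proof.
move=> Ax x0 conj_le1; have [r Dr] := closed_field_poly_normal (minCpoly x).
rewrite (monicP (minCpoly_monic x)) scale1r in Dr.
have root_r y : root (minCpoly x) y = (y \in r) by rewrite Dr root_prod_XsubC.
apply: (@prod_norm_le1_eq1 r); last by rewrite -root_r root_minCpoly.
  by move=> y; rewrite -root_r; apply: conj_le1.
have -> : \prod_(y <- r) `|y| = `|(minCpoly x)`_0|.
  rewrite -horner_coef0 Dr horner_prod normr_prod; apply: eq_bigr => y _.
  by rewrite hornerXsubC sub0r normrN.
rewrite norm_intr_ge1 ?minCpoly_coef0_neq0 //.
by move: Ax; rewrite unfold_in => /polyOverP; apply.
Qed.

Lemma norm_root_of_unity (w : algC) N : (0 < N)%N -> w ^+ N = 1 -> `|w| = 1.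
Proof.
by move=> N0 wN; apply/eqP; rewrite -(@pexpr_eq1 _ _ N) // -normrX wN normr1.
Qed.

Lemma norm_sub1_sqr (w : algC) : `|w| = 1 -> `|w - 1| ^+ 2 = 2 - w - w^*.
Proof.
move=> w1; rewrite normCK rmorphB rmorph1 /=.
have : w * w^* = 1 by rewrite -normCK w1 expr1n.
by move=> h; rewrite mulrBl mulrBr h; ring.
Qed.

(** The polynomial (m X + 1)^N - 1 is rational, so m y + 1 is an N-th root of
    unity for every conjugate y of x, and |y| <= 2 / |m| <= 1. Once |x| = 1 is
    known, |m x| = 2 forces the root of unity m x + 1 to be -1. *)
Lemma Aint_root_unity_sub1 (x : algC) (m : int) N :
    (0 < N)%N -> x \in Aint -> x != 0 -> 2 <= `|m| -> (m%:~R * x + 1) ^+ N = 1 ->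
  `|x| = 1 /\ m%:~R * x = - 2.
Proof.
move=> N0 Ax x0 m2 mx1.
have m2C : 2 <= `|m%:~R : algC|.
  by rewrite -intr_norm (ler_int _ 2).
have m0C : 0 < `|m%:~R : algC| by apply: lt_le_trans m2C.
pose q : {poly rat} := (m%:~R *: 'X + 1) ^+ N - 1.
have Dq y : (map_poly ratr q).[y] = (m%:~R * y + 1) ^+ N - 1 :> algC.
  rewrite rmorphB rmorphXn rmorphD !rmorph1 /=.
  rewrite map_polyZ map_polyX /= ratr_int.
  by rewrite !hornerE.
have conj_le2 y : root (minCpoly x) y -> `|m%:~R * y| <= 2.
  have [p [-> _] min_p] := minCpolyP x.
  have /dvdpP[r Dr] : (p %| q) by rewrite -min_p /root Dq mx1 subrr.
  move=> py; have : root (map_poly ratr q) y by rewrite Dr rmorphM rootM py orbT.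
  rewrite /root Dq subr_eq0 => /eqP/(norm_root_of_unity N0) h.
  rewrite -(addrK 1 (_ * y)); apply: le_trans (ler_normB _ _) _.
  by rewrite h normr1.
have x1 : `|x| = 1.
  apply: Aint_conjugates_le1 => // y /conj_le2; rewrite normrM => h.
  by rewrite -(ler_pM2l m0C) mulr1; apply: le_trans m2C.
split=> //; set w := m%:~R * x + 1.
have w1 : `|w| = 1 by apply: norm_root_of_unity mx1.
have m2E : `|m%:~R * x| = 2.
  apply/eqP; rewrite eq_le conj_le2 ?root_minCpoly //.
  by rewrite normrM x1 mulr1.
(* |w - 1| = 2 on the unit circle gives w^* = - 2 - w, hence (w + 1)^2 = 0. *)
have := norm_sub1_sqr w1; rewrite {1}/w addrK m2E => h.
have ww : w * w^* = 1 by rewrite -normCK w1 expr1n.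
have Dwc : w^* = - 2 - w.
  have -> : w^* = 2 - w - (2 - w - w^*) by ring.
  by rewrite -h; ring.
have /eqP : (w + 1) ^+ 2 = 0.
  have -> : (w + 1) ^+ 2 = 1 - w * (- 2 - w) by ring.
  by rewrite -Dwc ww subrr.
rewrite expf_eq0 /= addr_eq0 => /eqP w_m1.
have -> : m%:~R * x = w - 1 by rewrite /w addrK.
by rewrite w_m1; ring.
Qed.

Lemma sum_geometric_window (F : comPzRingType) (z : F) d (m : F) :
    \sum_(k < d.*2.+1) z ^+ k = m * z ^+ d ->
  z ^+ d.*2.+1 - 1 = m * (z ^+ d * (z - 1)).
Proof. by move=> h; rewrite subrX1 h; ring. Qed.

(** The integrality of m leaves only these possibilities. Writing u for a square
    root of z, m is the quotient of two differences u^(2d+1) - u^-(2d+1) and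
    u - u^-1, so this is a case of the classification of rational quotients of
    sines of rational angles. *)
Lemma root_unity_window (z : algC) N d (m : int) :
    (0 < N)%N -> z ^+ N = 1 -> z != 1 ->
    \sum_(k < d.*2.+1) z ^+ k = m%:~R * z ^+ d ->
  [\/ z ^+ d.*2.+1 = 1 /\ m = 0,
      exists2 b : bool, z ^+ d = (-1) ^+ b & m = (-1) ^+ b,
      exists2 b : bool, z ^+ d.+1 = (-1) ^+ b & m = - (-1) ^+ b
    | z ^+ 2 = z - 1].
Proof.
move=> N0 zN z1 /sum_geometric_window zm.
have z0 : z != 0.
  apply: contra_eq_neq zN => ->.
  by rewrite expr0n gtn_eqF // eq_sym oner_eq0.
have zdz0 : z ^+ d * (z - 1) != 0 by rewrite mulf_neq0 ?expf_neq0 ?subr_eq0.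
have [m0|m_neq0] := eqVneq m 0.
  by apply: Or41; split=> //; apply/eqP; rewrite -subr_eq0 zm m0 mul0r.
have [m2|m1] := lerP 2 `|m|.
  apply: Or44.
  have Az : z ^+ d * (z - 1) \in Aint.
    have Az : z \in Aint by apply: (Aint_unity_root N0); apply/unity_rootP.
    by rewrite rpredM ?rpredX // rpredB // rpred1.
  have [] := Aint_root_unity_sub1 N0 Az zdz0 m2.
    by rewrite -zm subrK -exprM mulnC exprM zN expr1n.
  have nz : `|z| = 1 by apply: norm_root_of_unity zN.
  rewrite normrM normrX nz expr1n mul1r => h _.
  have := norm_sub1_sqr nz; rewrite h expr1n => h2.
  (* |z| = |z - 1| = 1: the three points 0, 1 and z are equilateral. *)
  have Dzc : z^* = 1 - z.
    have -> : z^* = 2 - z - (2 - z - z^*) by ring.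
    by rewrite -h2; ring.
  have := normCK z; rewrite nz expr1n Dzc => h3.
  by rewrite h3; ring.
have {m1 m_neq0} [b Dm] : exists b : bool, m = (-1) ^+ b.
  have [|] : m = 1 \/ m = -1 by lia.
    by exists false.
  by exists true.
have mm : (m%:~R : algC) = (-1) ^+ b by rewrite Dm rmorphXn rmorphN1.
have : (z ^+ d - (-1) ^+ b) * (z ^+ d.+1 + (-1) ^+ b) = 0.
  have -> : 0 = (z ^+ d.*2.+1 - 1) - (-1) ^+ b * (z ^+ d * (z - 1)).
    by rewrite zm mm subrr.
  rewrite exprS -addnn exprS exprD; case: (b); ring.
move/eqP; rewrite mulf_eq0 subr_eq0 addr_eq0 => /orP[] /eqP zd.
  by apply: Or42; exists b.
apply: Or43; exists (~~ b); first by rewrite zd signrN.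
by rewrite Dm signrN opprK.
Qed.

(** * The window equation and its solutions with entries in {-1,0,1} *)

Definition periodic (T : Type) n (s : nat -> T) := forall i, s (i + n)%N = s i.

(** For L = 2d + 1 the window starting at i is the arc of radius d about i + d,
    whence the offset d on the right. *)
Definition window_eq (F : pzRingType) L d (m : int) (s : nat -> F) :=
  forall i, \sum_(k < L) s (i + k)%N = m%:~R * s (i + d)%N.

Lemma sum_shift_periodic (V : zmodType) h (s : nat -> V) i :
  periodic h s -> \sum_(k < h) s (i + k)%N = \sum_(k < h) s k.
Proof.
move=> s_h; elim: i => [//|i <-].
apply: (addrI (s i)); transitivity (\sum_(k < h.+1) s (i + k)%N).
  rewrite big_ord_recl addn0; congr (_ + _).
  by apply: eq_bigr => k _; rewrite /= addSnnS.
by rewrite big_ord_recr /= s_h addrC.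
Qed.

(** The window is a stretch of length 2d, of zero sum, followed by the term at
    i + 2d. *)
Lemma window_eq_half (F : comPzRingType) d (b : bool) (s : nat -> F) :
    (forall i, s (i + d)%N = (-1) ^+ b * s i) ->
    (forall i, \sum_(k < d.*2) s (i + k)%N = 0) ->
  window_eq d.*2.+1 d ((-1) ^+ b) s.
Proof.
move=> s_d s0 i; rewrite rmorphXn /= rmorphN1 big_ord_recr /= s0 add0r.
by rewrite -addnn addnA s_d.
Qed.

(** The window is a stretch of length 2d + 2, of zero sum, deprived of its last
    term, at i + 2d + 1. *)
Lemma window_eq_half_succ (F : comPzRingType) d (b : bool) (s : nat -> F) :
    (forall i, s (i + d.+1)%N = (-1) ^+ b * s i) ->
    (forall i, \sum_(k < d.+1.*2) s (i + k)%N = 0) ->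
  window_eq d.*2.+1 d (- (-1) ^+ b) s.
Proof.
move=> s_d s0 i; rewrite rmorphN rmorphXn /= rmorphN1.
have := s0 i; rewrite doubleS big_ord_recr /= => /eqP.
rewrite addr_eq0 => /eqP ->.
by rewrite -addnn -addnS addnA s_d mulNr.
Qed.

Section SimpleSolutions.

Variables (n L d : nat) (m : int).

Definition winmx (F : nzRingType) : 'M[F]_n.+1 :=
  \matrix_(j, i) (\sum_(k < L) (j == inZp (i + k))%:R
                  - m%:~R * (j == inZp (i + d))%:R).

Lemma inZp_modnDl i k : inZp (i %% n.+1 + k)%N = inZp (i + k) :> 'I_n.+1.
Proof. by apply: val_inj; rewrite /= modnDml. Qed.

Lemma mul_winmxP (F : comNzRingType) (x : 'rV[F]_n.+1) :
  x *m winmx F = 0 <-> window_eq L d m (fun i => x 0 (inZp i)).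
Proof.
have mulE i : (x *m winmx F) 0 i
    = \sum_(k < L) x 0 (inZp (i + k)) - m%:~R * x 0 (inZp (i + d)).
  have sumE (i0 : 'I_n.+1) : \sum_j x 0 j * (j == i0)%:R = x 0 i0.
    rewrite (bigD1 i0) //= eqxx mulr1 big1 ?addr0 // => j /negPf->.
    by rewrite mulr0.
  rewrite mxE; under eq_bigr do rewrite mxE mulrBr mulr_sumr mulrCA.
  rewrite sumrB exchange_big -mulr_sumr sumE; congr (_ - _).
  by apply: eq_bigr => k _; rewrite sumE.
split=> [x0 i|xw]; last first.
  by apply/rowP => i; rewrite mulE xw subrr mxE.
have /eqP := mulE (inZp i); rewrite x0 mxE eq_sym subr_eq0 /= => /eqP.
rewrite inZp_modnDl => <-.
by apply: eq_bigr => k _; rewrite inZp_modnDl.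
Qed.

Lemma map_winmx (F : numFieldType) : map_mx ratr (winmx rat) = winmx F.
Proof.
apply/matrixP=> i j; rewrite !mxE rmorphB rmorph_sum rmorphM /=.
rewrite ratr_int ratr_nat; congr (_ - _).
by apply: eq_bigr => k _; rewrite ratr_nat.
Qed.

Definition sign_row (F : pzRingType) (P Q : {set 'I_n.+1}) : 'rV[F]_n.+1 :=
  \row_j ((j \in P)%:R - (j \in Q)%:R).

(** A row for each pair of sets, hence for each sign vector; the pairs whose
    vector does not satisfy the window equation are given the zero row, so that
    the row space is exactly the span of the simple solutions. *)
Definition simple_mx : 'M[rat]_(#|{: {set 'I_n.+1} * {set 'I_n.+1}}|, n.+1) :=
  \matrix_k (let: (P, Q) := enum_val k in
             if sign_row rat P Q *m winmx rat == 0 then sign_row rat P Q else 0).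

Lemma simple_mx_ker : simple_mx *m winmx rat = 0.
Proof.
apply/row_matrixP=> k; rewrite row_mul row0 rowK.
by case: (enum_val k) => P Q; case: ifP => [/eqP //|_]; rewrite mul0mx.
Qed.

Lemma simple_mx_entry k j : simple_mx k j \in [:: -1; 0; 1].
Proof.
rewrite mxE; case: (enum_val k) => P Q; case: ifP => _; rewrite mxE //.
by case: (j \in P); case: (j \in Q).
Qed.

(** Solutions are produced as sequences on the natural numbers, where shifts need
    no reduction modulo the length of the circuit. *)
Lemma simple_solution_sub (F : numFieldType) (P Q : pred nat) :
    let s i : rat := (P i)%:R - (Q i)%:R in
    periodic n.+1 s -> window_eq L d m s ->
  (\row_(j < n.+1) ratr (s j) <= map_mx (@ratr F) simple_mx)%MS.
Proof.
move=> s s_per s_win.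
have s_mod i : s (i %% n.+1)%N = s i.
  rewrite {2}(divn_eq i n.+1) addnC.
  elim: (i %/ n.+1)%N => [|q IHq]; first by rewrite mul0n addn0.
  by rewrite mulSn addnCA addnC s_per.
pose X := [set j : 'I_n.+1 | P j]; pose Y := [set j : 'I_n.+1 | Q j].
have XYE j : sign_row rat X Y 0 j = s j by rewrite mxE !inE.
have XY_win : sign_row rat X Y *m winmx rat == 0.
  apply/eqP/mul_winmxP => i; rewrite XYE /= s_mod -s_win.
  by apply: eq_bigr => k _; rewrite XYE /= s_mod.
have <- : row (enum_rank (X, Y)) (map_mx (@ratr F) simple_mx)
          = \row_(j < n.+1) ratr (s j).
  apply/rowP=> j; rewrite !mxE enum_rankK XY_win.
  by rewrite XYE.
exact: row_sub.
Qed.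

(** Such sequences serve as the simple solutions: the difference makes the sum
    over a period vanish whatever the gap t. *)
Definition step N t r i : rat := (i %% N == r)%N%:R - ((i + t) %% N == r)%N%:R.

Lemma step_periodic N t r M : (N %| M)%N -> periodic M (step N t r).
Proof.
move=> /dvdnP[q ->] i; rewrite /step addnAC [(i + t + _)%N]addnC [(i + _)%N]addnC.
by rewrite !modnMDl.
Qed.

(** Both indicators are M-periodic, so that their sums over M consecutive terms
    do not depend on the starting point, i or i + t. *)
Lemma sum_step N t r M i : (N %| M)%N -> \sum_(k < M) step N t r (i + k) = 0.
Proof.
move=> NM; pose G i : rat := (i %% N == r)%N%:R.
have G_per : periodic M G.
  by case/dvdnP: NM => q -> j; rewrite /G addnC modnMDl.
rewrite sumrB (sum_shift_periodic i G_per).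
under [X in _ - X]eq_bigr do rewrite addnAC.
by rewrite (sum_shift_periodic (i + t) G_per) subrr.
Qed.

(** Summing z^r against the indicator of the class of r mod N gives back z^i, so
    that summing against the steps gives (1 - z^t) z^i; the gap t must only
    avoid z^t = 1. *)
Lemma power_row_sub (z : algC) N t :
    N.-primitive_root z -> (N %| n.+1)%N -> z ^+ t != 1 ->
    (forall r, window_eq L d m (step N t r)) ->
  (\row_(j < n.+1) z ^+ j <= map_mx (@ratr algC) simple_mx)%MS.
Proof.
move=> zN Nn zt s_win; have N0 := prim_order_gt0 zN.
have sumE i : \sum_(r < N) z ^+ r * (i %% N == r)%N%:R = z ^+ i.
  rewrite (bigD1 (Ordinal (ltn_pmod i N0))) //= eqxx mulr1 prim_expr_mod //.
  rewrite big1 ?addr0 // => r; rewrite -val_eqE /= eq_sym => /negPf->.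
  by rewrite mulr0.
have -> : \row_(j < n.+1) z ^+ j
    = (1 - z ^+ t)^-1 *: \sum_(r < N) z ^+ r *: \row_(j < n.+1) ratr (step N t r j).
  apply/rowP=> j; rewrite !mxE summxE.
  under eq_bigr do rewrite !mxE rmorphB /= !ratr_nat mulrBr.
  rewrite sumrB !sumE.
  have -> : z ^+ j - z ^+ (j + t) = (1 - z ^+ t) * z ^+ j by rewrite exprD; ring.
  by rewrite mulKf // subr_eq0 eq_sym.
apply/scalemx_sub/summx_sub => r _; apply: scalemx_sub.
apply: (@simple_solution_sub algC (fun i => i %% N == r)%N
                                  (fun i => (i + t) %% N == r)%N) (s_win r).
exact: step_periodic.
Qed.

(** The polynomial X^2 - X + 1 has no rational root, its discriminant being
    negative. *)
Lemma sixth_root_free (z : algC) (a b : rat) :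
  z ^+ 2 = z - 1 -> ratr a + ratr b * z = 0 -> a = 0 /\ b = 0.
Proof.
move=> z2; have [->|b0] := eqVneq b 0.
  by rewrite rmorph0 mul0r addr0 => /eqP; rewrite fmorph_eq0 => /eqP.
move=> abz; have Dz : z = ratr (- a / b).
  rewrite rmorphM rmorphN fmorphV /=.
  have b0C : ratr b != 0 :> algC by rewrite fmorph_eq0.
  apply: (mulIf b0C); rewrite divfK //; apply/eqP.
  by rewrite -addr_eq0 mulrC addrC abz.
pose c : rat := - a / b; rewrite -/c in Dz.
have : c ^+ 2 = c - 1.
  by apply: (fmorph_inj (@ratr algC)); rewrite rmorphXn rmorphB rmorph1 /= -Dz.
move: (c) => {Dz abz b0} {}c h; exfalso.
by have := sqr_ge0 (c - 1/2); nra.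
Qed.

(** The coordinates of z^i in the basis 1, z follow the 6-periodic patterns
    1, 0, -1, -1, 0, 1 and 0, 1, 1, 0, -1, -1. By uniqueness of coordinates,
    each pattern inherits from z^i both its period n + 1 and its window
    equation. *)
Lemma sixth_power_row_sub (z : algC) :
    z ^+ 2 = z - 1 -> z ^+ n.+1 = 1 ->
    \sum_(k < L) z ^+ k = m%:~R * z ^+ d ->
  (\row_(j < n.+1) z ^+ j <= map_mx (@ratr algC) simple_mx)%MS.
Proof.
move=> z2 zn z_win.
pose a i : rat := ((i %% 6)%N \in [:: 0; 5]%N)%:R - ((i %% 6)%N \in [:: 2; 3]%N)%:R.
pose b i : rat := ((i %% 6)%N \in [:: 1; 2]%N)%:R - ((i %% 6)%N \in [:: 4; 5]%N)%:R.
have z3 : z ^+ 3 = -1 by rewrite exprS z2 mulrBr -expr2 z2; ring.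
have z6 : z ^+ 6 = 1 by rewrite (exprM z 3 2) z3 sqrrN expr1n.
have zE i : z ^+ i = ratr (a i) + ratr (b i) * z.
  rewrite -(expr_mod _ z6) /a /b; move: (ltn_pmod i (isT : 0 < 6)%N).
  rewrite !rmorphB /= !ratr_nat.
  case: (i %% 6)%N => [|[|[|[|[|[|//]]]]]] _ /=; rewrite ?expr1 ?z2 ?z3
    ?(exprD z 3 1) ?(exprD z 3 2) ?z3 ?z2; ring.
have indep (u v u' v' : rat) :
    ratr u + ratr v * z = ratr u' + ratr v' * z -> u = u' /\ v = v'.
  move=> h; have [|/eqP + /eqP] := @sixth_root_free z (u - u') (v - v') z2.
    by rewrite !rmorphB /= mulrBl addrACA -opprD h subrr.
  by rewrite !subr_eq0 => /eqP + /eqP.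
have ab_per i : a (i + n.+1)%N = a i /\ b (i + n.+1)%N = b i.
  by apply: indep; rewrite -!zE exprD zn mulr1.
have ab_win i : \sum_(k < L) a (i + k)%N = m%:~R * a (i + d)%N /\
                \sum_(k < L) b (i + k)%N = m%:~R * b (i + d)%N.
  apply: indep; rewrite !rmorph_sum !rmorphM /= !ratr_int mulr_suml -big_split /=.
  under eq_bigr do rewrite -zE exprD.
  by rewrite -mulr_sumr z_win -mulrA -mulrDr -zE exprD; ring.
have -> : \row_(j < n.+1) z ^+ j
    = \row_(j < n.+1) ratr (a j) + z *: \row_(j < n.+1) ratr (b j).
  by apply/rowP=> j; rewrite !mxE zE [z * _]mulrC.
apply: addmx_sub; last apply: scalemx_sub.
  apply: (@simple_solution_sub algC (fun i => (i %% 6)%N \in [:: 0; 5]%N)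
                                    (fun i => (i %% 6)%N \in [:: 2; 3]%N)) => i.
    by case: (ab_per i).
  by case: (ab_win i).
apply: (@simple_solution_sub algC (fun i => (i %% 6)%N \in [:: 1; 2]%N)
                                  (fun i => (i %% 6)%N \in [:: 4; 5]%N)) => i.
  by case: (ab_per i).
by case: (ab_win i).
Qed.

End SimpleSolutions.

(** * Geometric rows are spanned by simple solutions *)

(** With z^e = 1 the gap 1 does, as e is a period. With z^e = -1 the gap e does,
    since a shift by e exchanges the two classes, 2e being a period. *)
Lemma step_half (F : fieldType) (z : F) N e (b : bool) :
    N.-primitive_root z -> z ^+ e = (-1) ^+ b ->
  let t := if b then e else 1%N in
  (N %| e.*2)%N /\
  (forall r i, step N t r (i + e) = (-1) ^+ b * step N t r i).
Proof.
move=> zN ze /=.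
have N2e : (N %| e.*2)%N.
  by rewrite (prim_order_dvd zN) -muln2 exprM ze sqrr_sign.
split=> // r i; case: b ze => ze.
  rewrite expr1 mulN1r /step -addnA addnn opprB; congr (_ - _).
  by case/dvdnP: N2e => q ->; rewrite addnC modnMDl.
by rewrite mul1r step_periodic // (prim_order_dvd zN) ze.
Qed.

Lemma sum_unity_root (F : fieldType) (z : F) N :
  z ^+ N = 1 -> z != 1 -> \sum_(k < N) z ^+ k = 0.
Proof.
move=> zN z1; apply: (mulfI (x := z - 1)); first by rewrite subr_eq0.
by rewrite -subrX1 zN subrr mulr0.
Qed.

(** The window has a full period when it covers the circuit or z^(2d+1) = 1, two
    half-windows when z^d or z^(d+1) is a sign; the remaining cases are z = 1,
    with constant rows, and the sixth roots of unity. *)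
Lemma window_root_sub n d (m : int) (z : algC) :
  let L := minn n.+1 d.*2.+1 in
  z ^+ n.+1 = 1 -> \sum_(k < L) z ^+ k = m%:~R * z ^+ d ->
  (\row_(j < n.+1) z ^+ j <= map_mx (@ratr algC) (simple_mx n L d m))%MS.
Proof.
move=> L zn z_win; have [z1|z1] := eqVneq z 1.
  have Dm : m = L :> int.
    apply: (@intr_inj algC); move: z_win; rewrite z1 expr1n mulr1 => <-.
    under eq_bigr do rewrite expr1n.
    by rewrite sumr_const card_ord.
  have -> : \row_(j < n.+1) z ^+ j = \row_(j < n.+1) ratr (1 - 0).
    by apply/rowP=> j; rewrite !mxE z1 expr1n subr0 rmorph1.
  apply: (@simple_solution_sub n L d m algC predT pred0) => // i.
  by rewrite sumr_const card_ord Dm subr0 mulr1.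
have [N zN Nn] := prim_order_exists (ltn0Sn n) zn.
have zero_case e : (N %| e)%N -> L = e -> m = 0 ->
    (\row_(j < n.+1) z ^+ j <= map_mx (@ratr algC) (simple_mx n L d m))%MS.
  move=> Ne De Dm; apply: (power_row_sub (t := 1) zN Nn); first by rewrite expr1.
  by move=> r i; rewrite De sum_step // Dm mul0r.
have zdz0 : z ^+ d != 0.
  rewrite expf_neq0 //; apply: contra_eq_neq zn => ->.
  by rewrite expr0n eq_sym oner_eq0.
have [Ln|Ld] := leqP n.+1 d.*2.+1.
  have DL : L = n.+1 by apply/minn_idPl.
  apply: (zero_case n.+1) => //; apply/eqP; move/esym/eqP: z_win.
  by rewrite DL (sum_unity_root zn z1) mulf_eq0 (negPf zdz0) orbF intr_eq0.
have DL : L = d.*2.+1 by apply/minn_idPr/ltnW.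
have half_case e (b : bool) : z ^+ e = (-1) ^+ b ->
    (forall t r, (N %| e.*2)%N ->
       (forall i, step N t r (i + e) = (-1) ^+ b * step N t r i) ->
       window_eq L d m (step N t r)) ->
    (\row_(j < n.+1) z ^+ j <= map_mx (@ratr algC) (simple_mx n L d m))%MS.
  move=> ze s_win; have [N2e s_e] := step_half zN ze.
  apply: (power_row_sub zN Nn) => [|r]; last exact: (s_win _ r N2e (s_e r)).
  case: (b) ze => [->|_]; last by rewrite expr1.
  by rewrite expr1 -subr_eq0 -opprD oppr_eq0 (pnatr_eq0 _ 2).
have z_win' := z_win; rewrite DL in z_win'.
case: (root_unity_window (ltn0Sn n) zn z1 z_win')
  => [[zL m0]|[b zd Dm]|[b zd Dm]|z2].
- by apply: (zero_case d.*2.+1) => //; rewrite (prim_order_dvd zN) zL eqxx.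
- apply: half_case zd _ => t r N2d s_d; rewrite DL Dm.
  by apply: window_eq_half => // i; apply: sum_step.
- apply: half_case zd _ => t r N2d s_d; rewrite DL Dm.
  by apply: window_eq_half_succ => // i; apply: sum_step.
exact: sixth_power_row_sub.
Qed.

Section Fourier.

Variables (n : nat) (w : algC) (w_prim : n.+1.-primitive_root w).

Definition fourier (x : 'rV[algC]_n.+1) (a : nat) : algC :=
  \sum_(j < n.+1) x 0 j * w ^- (a * j).

Lemma fourier_inversion (x : 'rV[algC]_n.+1) :
  x = n.+1%:R^-1 *: \sum_(a < n.+1) fourier x a *: \row_(j < n.+1) (w ^+ a) ^+ j.
Proof.
have w0 : w != 0 by rewrite (prim_root_eq0 w_prim).
apply/rowP=> j; rewrite !mxE summxE.
apply: (mulfI (x := n.+1%:R)); first by rewrite pnatr_eq0.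
rewrite mulVKf ?pnatr_eq0 //.
under eq_bigr do rewrite !mxE mulr_suml.
rewrite exchange_big (bigD1 j) //= [X in _ + X]big1 ?addr0 => [|l lj].
  under eq_bigr do rewrite -exprM mulfVK ?expf_neq0 //.
  by rewrite sumr_const card_ord mulr_natl.
rewrite (eq_bigr (fun a : 'I_n.+1 => x 0 l * (w ^- l * w ^+ j) ^+ a)) => [|a _].
  rewrite -mulr_sumr sum_unity_root ?mulr0 //.
    rewrite exprMn exprVn -!exprM ![(_ * n.+1)%N]mulnC !exprM.
    by rewrite (prim_expr_order w_prim) !expr1n invr1 mulr1.
  rewrite -(inj_eq (mulfI (expf_neq0 l w0))) mulVKf ?expf_neq0 // mulr1.
  by rewrite (eq_prim_root_expr w_prim) !modn_small // eq_sym.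
by rewrite -mulrA exprMn exprVn -!exprM [(l * a)%N]mulnC [(j * a)%N]mulnC.
Qed.

(** Shifting x by k multiplies its Fourier coefficient at z = w^a by z^k, so the
    transform of the window equation is the equation below multiplied by this
    coefficient, which can be cancelled. *)
Lemma fourier_support L d m (x : 'rV[algC]_n.+1) (a : nat) :
    x *m winmx n L d m algC = 0 -> fourier x a != 0 ->
  \sum_(k < L) (w ^+ a) ^+ k = m%:~R * (w ^+ a) ^+ d.
Proof.
move=> /mul_winmxP x_win c0; apply: (mulIf c0).
set z := w ^+ a.
have z0 : z != 0 by rewrite expf_neq0 // (prim_root_eq0 w_prim).
pose s i : algC := x 0 (inZp i) * z ^- i.
have s_per : periodic n.+1 s.
  move=> i; rewrite /s exprD -[z ^+ n.+1]exprM mulnC exprM (prim_expr_order w_prim).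
  rewrite expr1n mulr1; congr (x 0 _ * _).
  by apply: val_inj; rewrite /= modnDr.
have cE k : \sum_(i < n.+1) x 0 (inZp (i + k)) * z ^- i = z ^+ k * fourier x a.
  transitivity (z ^+ k * \sum_(i < n.+1) s (k + i)%N).
    rewrite mulr_sumr; apply: eq_bigr => i _.
    rewrite /s addnC exprD invfM mulrCA; congr (_ * _).
    by rewrite (mulVKf (expf_neq0 k z0)).
  rewrite (sum_shift_periodic k s_per); congr (_ * _); apply: eq_bigr => i _.
  by rewrite /s valZpK exprM.
rewrite mulr_suml -mulrA -cE mulr_sumr.
under eq_bigr do rewrite -cE.
rewrite exchange_big /=; apply: eq_bigr => i _.
by rewrite mulrA -x_win mulr_suml.
Qed.

End Fourier.

(** Both matrices are rational, so the inclusion may be checked over the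
    algebraic numbers, where the kernel has a Fourier basis. *)
Lemma ker_winmx_sub n d m (L := minn n.+1 d.*2.+1) :
  (kermx (winmx n L d m rat) <= simple_mx n L d m)%MS.
Proof.
rewrite -(map_submx (@ratr algC)) map_kermx map_winmx.
apply/rV_subP => x /sub_kermxP xM.
have [w w_prim] := C_prim_root_exists (ltn0Sn n).
rewrite (fourier_inversion w_prim x); apply/scalemx_sub/summx_sub => a _.
have [->|c0] := eqVneq (fourier w x a) 0; first by rewrite scale0r sub0mx.
apply/scalemx_sub/window_root_sub; last exact: fourier_support xM c0.
by rewrite -exprM mulnC exprM (prim_expr_order w_prim) expr1n.
Qed.

(** * Adjacency in the distance powers of a circuit *)

Lemma has_walk0 (T : finType) (e : rel T) x y : has_walk e 0 x y = (x == y).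
Proof.
apply/existsP/eqP => [[p]|->]; first by rewrite tuple0 => /eqP.
by exists [tuple]; rewrite /= eqxx.
Qed.

Lemma has_walkS (T : finType) (e : rel T) k x y :
  reflect (exists2 u, e x u & has_walk e k u y) (has_walk e k.+1 x y).
Proof.
apply: (iffP existsP) => [[p]|[u xu /existsP[p pP]]].
  case/tupleP: p => u p /= /andP[/andP[xu up] uy].
  by exists u => //; apply/existsP; exists p; rewrite up.
by exists (cons_tuple u p); rewrite /= xu.
Qed.

(** A shortest walk repeats no vertex, so it is found within the range searched
    by the distance; conversely the dummy value of the distance never exceeds
    the length of a walk too long for the range. *)
Lemma dist_powerP (T : finType) (e : rel T) d x y : (0 < d)%N -> x != y ->
  reflect (exists2 k, (k <= d)%N & has_walk e k x y) (dist_power e d x y).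
Proof.
move=> d0 xy; rewrite /dist_power /= xy /=.
apply: (iffP orP) => [[exy|/andP[/connectP[p0 p0P ->]]]|[k kd wk]].
- exists 1%N => //; apply/has_walkS; exists y => //.
  by rewrite has_walk0.
- case/shortenP: p0P => p pP p_uniq _ {xy p0}.
  set y' := last x p => gd.
  have p_lt : (size p < #|T|)%N.
    by rewrite -[(size p).+1]/(size (x :: p)) -(card_uniqP p_uniq) max_card.
  have wp : has_walk e (size p) x y'.
    by apply/existsP; exists (in_tuple p); rewrite /= pP eqxx.
  have wex : has (fun k => has_walk e k x y') (iota 0 #|T|).
    by apply/hasP; exists (size p); rewrite // mem_iota.
  exists (gdist e x y') => //; have := nth_find 0%N wex.
  by rewrite nth_iota // -[X in (_ < X)%N](size_iota 0) -has_find.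
right; case/existsP: (wk) => p /andP[pP /eqP py].
apply/andP; split; first by apply/connectP; exists p.
apply: leq_trans kd; rewrite leqNgt; apply/negP => /= k_lt.
have kT : (k < #|T|)%N.
  by apply: leq_trans k_lt _; rewrite -[X in (_ <= X)%N](size_iota 0) find_size.
by have := before_find 0%N k_lt; rewrite nth_iota // add0n wk.
Qed.

(** Closed balls of the circuit, written with additions only: j is reached from i
    by at most d steps in one of the two directions. *)
Definition near n d (i j : nat) :=
  exists2 a, (a <= d)%N &
    (i + a = j %[mod n] \/ j + a = i %[mod n])%N.

Lemma modn_succ_inj n i j : (i.+1 = j.+1 %[mod n] -> i = j %[mod n])%N.
Proof. by move=> h; apply/eqP; rewrite -(eqn_modDr 1) !addn1; apply/eqP. Qed.

Lemma circuitP n (i j : 'I_n) :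
  reflect (i.+1 = j %[mod n] \/ j.+1 = i %[mod n])%N (circuit i j).
Proof.
have ordSE (u v : 'I_n) : (v == ordS u) = (u.+1 == v %[mod n])%N.
  by rewrite -val_eqE /= eq_sym [(v %% n)%N]modn_small.
by rewrite /circuit /= !ordSE; apply: (iffP orP) => -[] /eqP; auto.
Qed.

(** Steps in opposite directions cancel, so a walk moves its origin by at most
    its length in a single direction. *)
Lemma walk_near n k (i j : 'I_n) : has_walk (@circuit n) k i j -> near n k i j.
Proof.
elim: k i => [|k IHk] i.
  by rewrite has_walk0 => /eqP->; exists 0%N => //; rewrite addn0; left.
case/has_walkS => u /circuitP iu /IHk[a ak ua].
have add1 (x y c : nat) : (x = y %[mod n] -> x + c = y + c %[mod n])%N.
  by move=> h; rewrite -modnDml h modnDml.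
case: iu ua => [iu|iu] [ua|ua].
- by exists a.+1 => //; left; rewrite addnS -addSn -ua; apply: add1.
- case: a ak ua => [|a] ak ua.
    by exists 1%N => //; left; move: ua; rewrite addn0 addn1 iu => ->.
  exists a; first exact: ltnW (ltnW _).
  by right; apply: modn_succ_inj; rewrite -addnS ua iu.
- case: a ak ua => [|a] ak ua.
    exists 1%N => //; right; rewrite -iu -[u.+1]addn1; apply: add1.
    by rewrite -ua addn0.
  exists a; first exact: ltnW (ltnW _).
  by left; rewrite -ua addnS -addSn; apply: add1.
exists a.+1 => //; right; rewrite addnS -iu -[(j + a).+1]addn1 -[u.+1]addn1.
exact: add1.
Qed.

Lemma walk_forth n a (i j : 'I_n) :
  (i + a = j %[mod n])%N -> has_walk (@circuit n) a i j.
Proof.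
elim: a i => [|a IHa] i.
  by rewrite addn0 !modn_small // has_walk0 => /val_inj->.
move=> ij; apply/has_walkS; exists (ordS i); first by rewrite /circuit /= eqxx.
by apply: IHa; rewrite /= modnDml addSnnS.
Qed.

Lemma walk_back n a (i j : 'I_n) :
  (j + a = i %[mod n])%N -> has_walk (@circuit n) a i j.
Proof.
elim: a i => [|a IHa] i.
  by rewrite addn0 !modn_small // has_walk0 => /val_inj->.
have n0 : (0 < n)%N by apply: leq_ltn_trans (ltn_ord i).
move=> ij; apply/has_walkS; exists (Ordinal (ltn_pmod (j + a) n0)).
  by apply/circuitP; right; rewrite /= -addn1 modnDml addn1 -addnS.
by apply: IHa; rewrite /= modn_mod.
Qed.

Lemma dist_power_circuitP n d (i j : 'I_n) : (0 < d)%N -> i != j ->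
  reflect (near n d i j) (dist_power (@circuit n) d i j).
Proof.
move=> d0 ij; apply: (iffP (dist_powerP _ d0 ij)) => [[k kd /walk_near[a ak ?]]|].
  by exists a => //; apply: leq_trans kd.
by case=> a ad [/walk_forth|/walk_back] w; exists a.
Qed.

Lemma dist_power_circuit_irr n d (i : 'I_n) : (1 < n)%N ->
  dist_power (@circuit n) d i i = false.
Proof.
move=> n1; rewrite /dist_power /circuit /= eqxx orbF orbb -val_eqE /=; apply/negbTE.
have [i1|i1] := ltnP i.+1 n; first by rewrite modn_small // ltn_eqF.
have -> : i.+1 = n by apply/eqP; rewrite eqn_leq i1 ltn_ord.
by rewrite modnn; lia.
Qed.

(** If 2d + 1 <= n the arc of radius d about i + d does not overlap itself, and
    it starts at i; otherwise it covers the circuit, like the window k < n. *)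
Lemma near_window n d i k : (k < n)%N ->
  near n d ((i + d) %% n) ((i + k) %% n) <-> (k < d.*2.+1)%N.
Proof.
move=> kn; have addK (x y : nat) : (i + x = i + y %[mod n] <-> x = y %[mod n])%N.
  by split=> /eqP h; apply/eqP; move: h; rewrite eqn_modDl.
rewrite /near; split=> [[a ad]|kd].
  rewrite !modnDml !modn_mod -!addnA !addK => h.
  have [nd|nd] := leqP n d.*2; first lia.
  move: h; rewrite (modn_small kn).
  have dn : (d < n)%N by lia.
  rewrite (modn_small dn) => -[]; first by rewrite modn_small; lia.
  have [kan|kan] := ltnP (k + a) n; first by rewrite modn_small //; lia.
  by rewrite -(subnK kan) modnDr modn_small; lia.
have [dk|kd'] := leqP d k.
  exists (k - d)%N; first lia.
  by left; rewrite modnDml modn_mod -addnA subnKC.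
exists (d - k)%N; first lia.
by right; rewrite modnDml modn_mod -addnA subnKC // ltnW.
Qed.

Lemma sum_inZp_shift (V : zmodType) n i (f : 'I_n.+1 -> V) :
  \sum_j f j = \sum_(k < n.+1) f (inZp (i + k)).
Proof.
rewrite (@sum_shift_periodic V _ (fun k => f (inZp k))).
  by apply: eq_bigr => j _; rewrite valZpK.
by move=> k; congr f; apply: val_inj; rewrite /= modnDr.
Qed.

(** The added term x_(i+d) completes the neighbourhood of i + d into a closed
    ball, which is the arc that starts at i. *)
Lemma adjmx_window (R : realType) n d (x : 'cV[R]_n.+1) i :
    (1 < n.+1)%N -> (0 < d)%N ->
  (adjmx R (dist_power (@circuit n.+1) d) *m x) (inZp (i + d)) 0
  + x (inZp (i + d)) 0
  = \sum_(k < minn n.+1 d.*2.+1) x (inZp (i + k)) 0.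
Proof.
move=> n1 d0; set c := inZp _; rewrite mxE.
have -> : x c 0 = \sum_j (c == j)%:R * x j 0.
  rewrite (bigD1 c) //= eqxx mul1r big1 ?addr0 // => j.
  by rewrite eq_sym => /negPf->; rewrite mul0r.
rewrite -big_split /=.
transitivity (\sum_(k < n.+1) (k < d.*2.+1)%N%:R * x (inZp (i + k)) 0).
  rewrite (sum_inZp_shift i); apply: eq_bigr => k _; rewrite mxE -mulrDl.
  congr (_ * _); have := near_window d i (ltn_ord k).
  have [ck|ck] := eqVneq c (inZp (i + k)).
    rewrite -ck dist_power_circuit_irr // add0r => h.
    suff /h-> : near n.+1 d ((i + d) %% n.+1) ((i + k) %% n.+1) by [].
    have ckE : ((i + d) %% n.+1 = (i + k) %% n.+1)%N := congr1 val ck.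
    by exists 0%N => //; left; rewrite addn0 ckE.
  rewrite addr0 => h; congr (_%:R); congr nat_of_bool.
  by apply/(dist_power_circuitP d0 ck)/idP => /h.
rewrite (big_ord_widen n.+1 (fun k => x (inZp (i + k)) 0)) ?geq_minl //.
rewrite [RHS]big_mkcond; apply: eq_bigr => k _.
by rewrite leq_min ltn_ord /=; case: ifP; rewrite ?mul1r ?mul0r.
Qed.

(** * Simply structured bases *)

(** Scan the family and keep the vectors outside the span of the following ones. *)
Lemma span_sub_basis (K : fieldType) (vT : vectType K) (X : seq vT) :
  exists2 b, basis_of <<X>>%VS b & {subset b <= X}.
Proof.
elim: X => [|v X [b bX b_sub]].
  by exists [::] => //; rewrite span_nil nil_basis.
have [vX|vX] := boolP (v \in <<X>>%VS).
  exists b; last by move=> u /b_sub; rewrite inE orbC => ->.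
  by rewrite span_cons (addv_idPr _) // -memvE.
exists (v :: b); last first.
  by move=> u; rewrite !inE => /predU1P[->|/b_sub->]; rewrite ?eqxx ?orbT.
by rewrite /basis_of free_cons !span_cons (span_basis bX) eqxx vX (basis_free bX).
Qed.

Lemma eigen_winmx (R : realType) n d (lam : int) (x : 'cV[R]_n.+1) :
    (1 < n.+1)%N -> (0 < d)%N ->
  (x \in passmx.leigenspace
           (mxend (adjmx R (dist_power (@circuit n.+1) d))) lam%:~R)
  = (x^T *m winmx n (minn n.+1 d.*2.+1) d (lam + 1) R == 0).
Proof.
move=> n1 d0; rewrite mem_leigenspace_mxend.
have winE i := adjmx_window x i n1 d0.
apply/eqP/eqP => [Ax|/mul_winmxP x_win].
  apply/mul_winmxP => i; under eq_bigr do rewrite mxE.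
  by rewrite -winE Ax !mxE intrD mulrDl mul1r.
apply/colP=> c.
(* c is the centre of the window that starts at c - d modulo n + 1. *)
have Dc : c = inZp (c + n.+1 - d %% n.+1 + d).
  apply: val_inj; rewrite /= -modnDmr subnK; last first.
    by rewrite (leq_trans (ltnW (ltn_pmod d _))) ?leq_addl.
  by rewrite modnDr modn_small.
apply: (addIr (x c 0)); rewrite Dc winE !mxE.
have := x_win (c + n.+1 - d %% n.+1)%N; rewrite mxE intrD mulrDl mul1r => <-.
by apply: eq_bigr => k _; rewrite mxE.
Qed.

Theorem theorem10 (R : realType) (n d : nat) (hn : (3 <= n)%N) (hd : (1 <= d)%N)
    (lam : int) :
  let A : 'M[R]_n := adjmx R (dist_power (@circuit n) d) in
  passmx.leigenvalue (mxend A) lam%:~R ->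
  exists b : seq 'cV[R]_n,
    basis_of (passmx.leigenspace (mxend A) lam%:~R) b /\ simply_structured b.
Proof.
move=> A _; rewrite {}/A; case: n hn => // n hn.
set U := passmx.leigenspace _ _.
set L := minn n.+1 d.*2.+1; pose S := simple_mx n L d (lam + 1).
have memU x : (x \in U) = (x^T *m winmx n L d (lam + 1) R == 0).
  by rewrite eigen_winmx // ltnW.
pose v k : 'cV[R]_n.+1 := (row k (map_mx ratr S))^T.
have SR_ker : map_mx ratr S *m winmx n L d (lam + 1) R = 0.
  by rewrite -map_winmx -map_mxM simple_mx_ker map_mx0.
have kerS : (kermx (winmx n L d (lam + 1) R) <= map_mx ratr S)%MS.
  by rewrite -map_winmx -map_kermx map_submx ker_winmx_sub.
have DU : U = <<codom v>>%VS.
  apply/eqP; rewrite eqEsubv; apply/andP; split; apply/subvP => x.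
    rewrite memU => /eqP/sub_kermxP/submx_trans/(_ kerS)/submxP[u Du].
    have -> : x = \sum_k u 0 k *: v k.
      rewrite -[x]trmxK Du mulmx_sum_row linear_sum; apply: eq_bigr => k _.
      by rewrite linearZ.
    by apply: memv_suml => k _; apply/memvZ/memv_span/codom_f.
  apply/subvP: x; apply/span_subvP => _ /codomP[k ->].
  by rewrite memU trmxK -row_mul SR_ker row0.
have [b b_basis b_sub] := span_sub_basis (codom v).
exists b; split; first by rewrite DU.
move=> _ /b_sub/codomP[k ->] i; rewrite 3!mxE.
have := simple_mx_entry L d (lam + 1) k i; rewrite -/S.
rewrite !inE => /or3P[]/eqP ->.
- by rewrite rmorphN1 eqxx.
- by rewrite rmorph0 eqxx orbT.
- by rewrite rmorph1 eqxx !orbT.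
Qed.
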